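(* For every $n,\lambda\in\mathbb{N}$ with $n\ge3$, and each $\mu\in\{0,\dots,\lambda\}$, we have $$OP_{\Gamma_n,\operatorname{Aut}(\Gamma_n)}(\lambda,\mu)=\frac12\,OP_{\Gamma_n,\operatorname{Rot}(\Gamma_n)}(\lambda,\mu)+\frac{\lambda-\mu}{2}\,P_{\Pi_{(n-3)/2}}(\lambda,\mu)$$ if $n$ is odd, and $$OP_{\Gamma_n,\operatorname{Aut}(\Gamma_n)}(\lambda,\mu)=\frac12\,OP_{\Gamma_n,\operatorname{Rot}(\Gamma_n)}(\lambda,\mu)+\frac14\,P_{\Pi_{n/2}}(\lambda,\mu)+\frac{(\lambda-\mu)^2}{4}\,P_{\Pi_{n/2-3}}(\lambda,\mu)$$ if $n$ is even, where $\Pi_{-1}$ is interpreted as the empty graph.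
   Context: $\mathbb{N}$ denotes the positive integers. $\Gamma_n$ is the cycle of length $n$, with vertex set $\{0,\dots,n-1\}$ and edges $\{v,(v+1)\bmod n\}$ for $v=0,\dots,n-1$. $\Pi_n$ is the path of length $n$ (with $n+1$ vertices). $\operatorname{Aut}(\Gamma)$ is the automorphism group of a graph $\Gamma$, viewed as a group of permutations of the vertices; for $n\ge3$, $\operatorname{Aut}(\Gamma_n)$ is the dihedral group of order $2n$. $\operatorname{Rot}(\Gamma_n)=\{r_0,\dots,r_{n-1}\}$ is the subgroup of rotations, where $r_m(v)=(v+m)\bmod n$. A $\lambda$-coloring of $\Gamma$ is a map $f$ from the vertex set of $\Gamma$ to $\{1,\dots,\lambda\}$; it is $\mu$-proper if for every pair of adjacent vertices $v,w$, either $f(v)\ne f(w)$ or $f(v)=f(w)>\mu$. $P_\Gamma(\lambda,\mu)$ is the number of $\mu$-proper $\lambda$-colorings of $\Gamma$ (so it equals $1$ for the empty graph). For a subgroup $G$ of $\operatorname{Aut}(\Gamma)$, $OP_{\Gamma,G}(\lambda,\mu)$ is the number of equivalence classes of $\mu$-proper $\lambda$-colorings of $\Gamma$, where $f$ and $f'$ are equivalent if $f'=f\circ g$ for some $g\in G$. *)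

(* Defs.v *)
From HB Require Import structures.
From mathcomp Require Import all_boot all_order all_algebra all_fingroup.
Set Implicit Arguments.
Unset Strict Implicit.
Unset Printing Implicit Defensive.
Import GRing.Theory.

(* A finite graph is given by its vertex type T and adjacency relation e.     *)

Section Graphs.
Variables (T : finType) (e : rel T).

Definition graph_aut : {set {perm T}} :=
  [set g : {perm T} | [forall v, forall w, e (g v) (g w) == e v w]].

Lemma graph_aut_group_set : group_set graph_aut.
Proof.
apply/group_setP; split=> [|g h]; rewrite !inE.
  by apply/forallP=> v; apply/forallP=> w; rewrite !perm1.
move=> /forallP gP /forallP hP; apply/forallP=> v; apply/forallP=> w.
rewrite !permM (eqP (forallP (hP _) _)); exact: forallP (gP v) w.
Qed.

Canonical graph_aut_group := Group graph_aut_group_set.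

Variables lambda mu : nat.

(* The colors 1, ..., lambda are encoded by 'I_lambda, c standing for c.+1.   *)
Definition coloring := {ffun T -> 'I_lambda}.

Definition color (f : coloring) (v : T) : nat := (f v).+1.

Definition mu_proper (f : coloring) : bool :=
  [forall v, forall w, e v w ==>
    (color f v != color f w)
    || ((color f v == color f w) && (mu < color f v))].

Definition proper_colorings : {set coloring} := [set f | mu_proper f].

Definition num_colorings : nat := #|proper_colorings|.

Definition coloring_equiv (G : {set {perm T}}) (f f' : coloring) : bool :=
  [exists g in G, f' == [ffun v => f (g v)]].

Lemma coloring_equiv_equivalence (G : {group {perm T}}) :
  equivalence_rel (coloring_equiv G).
Proof.
have refl f : coloring_equiv G f f.
  apply/exists_inP; exists 1%g => //.
  by apply/eqP/ffunP=> v; rewrite ffunE perm1.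
have sym f f' : coloring_equiv G f f' -> coloring_equiv G f' f.
  case/exists_inP=> g gG /eqP ->; apply/exists_inP; exists g^-1%g.
    by rewrite groupV.
  by apply/eqP/ffunP=> v; rewrite !ffunE permKV.
have trans f f' f'' : coloring_equiv G f f' -> coloring_equiv G f' f'' ->
    coloring_equiv G f f''.
  case/exists_inP=> g gG /eqP -> /exists_inP[h hG /eqP ->].
  apply/exists_inP; exists (h * g)%g; first exact: groupM.
  by apply/eqP/ffunP=> v; rewrite !ffunE permM.
move=> f f' f''; split=> [//|ff']; apply/idP/idP=> H.
  exact: trans (sym _ _ ff') H.
exact: trans ff' H.
Qed.

(* Meaningful when G is a group, so that coloring_equiv G is an equivalence.  *)
Definition num_coloring_classes (G : {set {perm T}}) : nat :=
  #|equivalence_partition (coloring_equiv G) proper_colorings|.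

End Graphs.

Definition cycle_edge (n : nat) : rel 'I_n :=
  fun v w => (w == v.+1 %% n :> nat) || (v == w.+1 %% n :> nat).

Lemma cycle_edge_sym n : symmetric (@cycle_edge n).
Proof. by move=> v w; rewrite /cycle_edge orbC. Qed.

Lemma cycle_edge_irr n : 1 < n -> irreflexive (@cycle_edge n).
Proof.
move=> n1 v; rewrite /cycle_edge orbb; apply/negbTE.
have [vn|nv] := ltnP v.+1 n; first by rewrite modn_small // neq_ltn leqnn.
have vn : v.+1 = n by apply/eqP; rewrite eqn_leq nv ltn_ord.
by rewrite vn modnn -lt0n -ltnS vn.
Qed.

(* A path of length l has l + 1 vertices; the path of length -1 is empty.     *)
Definition path_order (l : int) : nat :=
  match l with Posz m => m.+1 | Negz _ => 0 end.

Definition path_edge (l : int) : rel 'I_(path_order l) :=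
  fun v w => (w == v.+1 :> nat) || (v == w.+1 :> nat).

Lemma ord_pos n (v : 'I_n) : 0 < n.
Proof. exact: leq_ltn_trans (ltn_ord v). Qed.

Definition rotation_fun (n m : nat) (v : 'I_n) : 'I_n :=
  Ordinal (ltn_pmod (v + m) (ord_pos v)).

Lemma rotation_fun_inj n m : injective (@rotation_fun n m).
Proof.
move=> v w [] /eqP; rewrite eqn_modDr !modn_small // => /eqP.
exact: val_inj.
Qed.

Definition rotation (n m : nat) : {perm 'I_n} := perm (@rotation_fun_inj n m).

Definition rotations (n : nat) : {set {perm 'I_n}} :=
  [set rotation n m | m : 'I_n].

Lemma rotations_group_set n : 0 < n -> group_set (rotations n).
Proof.
move=> n0; apply/group_setP; split.
  apply/imsetP; exists (Ordinal n0) => //; apply/permP=> v; apply: val_inj.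
  by rewrite perm1 permE /= addn0 modn_small.
move=> _ _ /imsetP[a _ ->] /imsetP[b _ ->]; apply/imsetP.
exists (Ordinal (ltn_pmod (a + b) n0)) => //; apply/permP=> v; apply: val_inj.
by rewrite permM !permE /= modnDml modnDmr addnA.
Qed.

Lemma rotations_sub_aut n : rotations n \subset graph_aut (@cycle_edge n).
Proof.
apply/subsetP=> _ /imsetP[m _ ->]; rewrite inE.
have E (v w : 'I_n) :
    ((w + m) %% n == ((v + m) %% n).+1 %% n) = (w == v.+1 %% n :> nat).
  rewrite -addn1 modnDml -addnA (addnC m) addnA eqn_modDr addn1.
  by rewrite modn_small.
by apply/forallP=> v; apply/forallP=> w; rewrite /cycle_edge !permE /= !E.
Qed.

(* Main.v *)
(* By Burnside's lemma, 2n OP_Aut = n OP_Rot + (sum over the reflections of the number of proper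
   colorings they fix). Conjugation by r_1 turns v |-> m - v into v |-> m + 2 - v, so only the
   reflections v |-> -v and v |-> n - 1 - v have to be counted. A coloring fixed by a reflection is
   a coloring of the folded cycle: a path with a loop at each end that is the midpoint of an edge
   crossed by the axis. A looped vertex takes any of the lambda - mu colors above mu, and then its
   other edges impose no condition. *)
Require Import Defs.
From HB Require Import structures.
From mathcomp Require Import all_boot all_order all_algebra all_fingroup.
From mathcomp Require Import zify lra.
Set Implicit Arguments.
Unset Strict Implicit.
Unset Printing Implicit Defensive.
Import GRing.Theory.
Local Open Scope ring_scope.

(** * Fixed colorings and Burnside's lemma *)

Section FixedColorings.
Local Open Scope nat_scope.
Variables (T : finType) (e : rel T) (lambda mu : nat).
Implicit Types (f : coloring T lambda) (g h : {perm T}).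

Lemma mu_properP f :
  reflect (forall v w, e v w -> f v = f w -> mu <= f v) (mu_proper e mu f).
Proof.
apply: (iffP forallP) => [H v w evw fvw | H v].
  by move/forallP: (H v) => /(_ w); rewrite evw /color fvw eqxx ltnS.
apply/forallP=> w; apply/implyP=> evw; rewrite /color eqSS ltnS.
by have [/val_inj/(H v w evw) | //] := eqVneq (f v : nat) (f w).
Qed.

Definition recolor f g : coloring T lambda := [ffun v => f (g v)].

Definition fixed_colorings g : {set coloring T lambda} :=
  [set f in proper_colorings e lambda mu | recolor f g == f].

Lemma in_fixed_colorings f g : (f \in fixed_colorings g)
  = (f \in proper_colorings e lambda mu) && (recolor f g == f).
Proof. by rewrite /fixed_colorings in_set. Qed.

Lemma recolor_proper f g : g \in graph_aut e ->
  (recolor f g \in proper_colorings e lambda mu)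
    = (f \in proper_colorings e lambda mu).
Proof.
rewrite !inE => /forallP gP.
have eg v w : e (g v) (g w) = e v w by have /forallP/(_ w)/eqP := gP v.
apply/mu_properP/mu_properP=> H v w evw.
  by have := H (g^-1 v)%g (g^-1 w)%g; rewrite !ffunE -eg !permKV; apply.
by rewrite !ffunE; apply: H; rewrite eg.
Qed.

(* Permutations compose from left to right, hence the inverse. *)
Definition coloring_act f g := recolor f g^-1.

Lemma coloring_act_is_action : is_action [set: {perm T}] coloring_act.
Proof.
split=> [g f1 f2 /ffunP E | f g h _ _].
  by apply/ffunP=> v; have := E (g v); rewrite !ffunE permK.
by apply/ffunP=> v; rewrite !ffunE invMg permM.
Qed.

Canonical coloring_action := Action coloring_act_is_action.

(** The equivalence classes are the orbits of [coloring_action] on the proper colorings, and [g]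
    acts trivially on f exactly when f o g = f, so the Cauchy-Frobenius orbit count applies. *)
Lemma coloring_classes_Burnside (G : {group {perm T}}) : G \subset graph_aut e ->
  num_coloring_classes e lambda mu G * #|G| = \sum_(g in G) #|fixed_colorings g|.
Proof.
move=> sGA; set S := proper_colorings e lambda mu.
have actS : [acts G, on S | coloring_action].
  apply/subsetP=> g gG; rewrite !inE; apply/subsetP=> f fS; rewrite inE /=.
  by rewrite /coloring_act recolor_proper // groupV (subsetP sGA).
have -> : num_coloring_classes e lambda mu G = #|orbit coloring_action G @: S|.
  congr #|pred_of_set _|; apply: eq_in_imset => f fS; apply/setP=> f'.
  rewrite inE; apply/andP/imsetP=> [[_ /exists_inP[g gG /eqP->]] | [g gG ->]].
    exists g^-1%g; rewrite ?groupV //.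
    by apply/ffunP=> v; rewrite !ffunE invgK.
  split; first by rewrite /= /coloring_act recolor_proper // groupV (subsetP sGA).
  by apply/exists_inP; exists g^-1%g; rewrite ?groupV.
rewrite -(Frobenius_Cauchy actS); apply: eq_bigr => g gG.
apply: eq_card => f; rewrite !inE sub1set inE; congr (_ && _).
apply/eqP/eqP=> /ffunP E; apply/ffunP=> v.
  by have := E (g v); rewrite !ffunE permK.
by have := E (g^-1 v)%g; rewrite !ffunE permKV.
Qed.

(** Since (g ^ h)(h v) = h (g v), the map f |-> f o h sends the colorings fixed by [g ^ h]
    bijectively onto those fixed by [g]. *)
Lemma card_fixed_coloringsJ g h : h \in graph_aut e ->
  #|fixed_colorings (g ^ h)| = #|fixed_colorings g|.
Proof.
move=> hA; have inj : injective (recolor^~ h).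
  move=> f1 f2 /ffunP E; apply/ffunP=> v.
  by have := E (h^-1 v)%g; rewrite !ffunE permKV.
rewrite -(card_imset _ inj); apply: eq_card => f.
have -> : f = recolor (recolor f h^-1) h by apply/ffunP=> v; rewrite !ffunE permK.
set f' := recolor f _; rewrite (mem_imset _ _ inj).
rewrite !in_fixed_colorings recolor_proper //; congr (_ && _).
apply/eqP/eqP=> /ffunP E; apply/ffunP=> v.
  by have := E (h v); rewrite !ffunE permJ.
by have := E (h^-1 v)%g; rewrite !ffunE conjgE !permM permKV.
Qed.

End FixedColorings.

(** * Quotient graphs and looped vertices *)

(** Here [U] is the quotient of [T] by [s], with projection [fold] and section [unfold]. A fixed
    coloring is constant on each pair v, s v, so it factors uniquely through [fold]; the last two
    hypotheses make [e'] the image of [e], loops included. *)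
Lemma card_fixed_colorings_fold (T U : finType) (e : rel T) (e' : rel U)
    (lambda mu : nat) (s : {perm T}) (fold : T -> U) (unfold : U -> T) :
    cancel unfold fold ->
    (forall v, fold (s v) = fold v) ->
    (forall v, unfold (fold v) = v \/ unfold (fold v) = s v) ->
    (forall v w, e v w -> e' (fold v) (fold w)) ->
    (forall a b, e' a b ->
       e (unfold a) (unfold b) \/ e (unfold a) (s (unfold b))) ->
  #|fixed_colorings e lambda mu s| = num_colorings e' lambda mu.
Proof.
move=> unfoldK foldS unfoldP eS eP.
pose ext (f : coloring U lambda) : coloring T lambda := [ffun v => f (fold v)].
have ext_inj : injective ext.
  move=> f1 f2 /ffunP E; apply/ffunP=> a.
  by have := E (unfold a); rewrite !ffunE unfoldK.
rewrite /num_colorings -(card_imset _ ext_inj); apply: eq_card => f.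
apply/idP/imsetP=> [|[f' + ->]]; rewrite !inE.
  case/andP=> /mu_properP fP /eqP/ffunP fS.
  have fsE v : f (s v) = f v by have := fS v; rewrite ffunE.
  exists [ffun a => f (unfold a)].
    rewrite inE; apply/mu_properP=> a b /eP; rewrite !ffunE.
    by case=> /fP; rewrite ?fsE.
  apply/ffunP=> v; rewrite !ffunE.
  by case: (unfoldP v) => ->; rewrite ?fsE.
move=> /mu_properP fP; apply/andP; split.
  by apply/mu_properP=> v w /eS/fP; rewrite !ffunE.
by apply/eqP/ffunP=> v; rewrite !ffunE foldS.
Qed.

(** The ordinal c encodes the color c + 1, so [mu <= c] says that the color exceeds [mu]. *)
Lemma card_large_colors (lambda mu : nat) :
  #|[set c : 'I_lambda | (mu <= c)%N]| = (lambda - mu)%N.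
Proof.
rewrite -sum1dep_card big_mkcond /=.
elim: lambda => [|l IH]; rewrite ?big_ord0 // big_ord_recr /= IH. by case: ifP => H; lia.
Qed.

(** Every vertex outside the image of [i] has a loop, hence a color above [mu]. An edge at such a
    vertex then holds automatically: if its ends agree, their common color is above [mu]. The looped
    vertices are thus colored independently of everything else. *)
Lemma num_colorings_looped (T U : finType) (e : rel T) (e' : rel U)
    (lambda mu : nat) (i : T -> U) :
    injective i ->
    (forall a b, e' (i a) (i b) = e a b) ->
    (forall x, x \notin codom i -> e' x x) ->
  num_colorings e' lambda mu
  = ((lambda - mu) ^ (#|U| - #|T|) * num_colorings e lambda mu)%N.
Proof.
move=> i_inj eE loop.
pose res (f : coloring U lambda) : coloring T lambda := [ffun a => f (i a)].
(* [F g x] is the set of colors allowed at [x] once the restriction to [T] is [g]; the fiber of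
   [res] over a proper [g] is the product of these sets. *)
pose F (g : coloring T lambda) (x : U) : {set 'I_lambda} :=
  if [pick a | i a == x] is Some a then [set g a] else [set c : 'I_lambda | (mu <= c)%N].
have Fi g a : F g (i a) = [set g a].
  rewrite /F; case: pickP => [b /eqP/i_inj-> // | /(_ a)]; by rewrite eqxx.
have FN g x : x \notin codom i -> F g x = [set c : 'I_lambda | (mu <= c)%N].
  rewrite /F; case: pickP => // a /eqP<-; by rewrite codom_f.
have properF f : (f \in proper_colorings e' lambda mu)
    = (res f \in proper_colorings e lambda mu) && (f \in family (F (res f))).
  rewrite !inE; apply/mu_properP/andP=> [fP | [/mu_properP rP /familyP fF] x y].
    split; first by apply/mu_properP=> a b eab; rewrite !ffunE => /fP-> //; rewrite eE.
    apply/familyP=> x; have [/codomP[a ->] | Nx] := boolP (x \in codom i).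
      by rewrite Fi inE ffunE.
    by rewrite FN // inE; apply: fP => //; exact: loop.
  have large z : z \notin codom i -> (mu <= f z)%N.
    by move=> Nz; have := fF z; rewrite FN // inE.
  have [/codomP[a ->] | Nx] := boolP (x \in codom i); last by move=> *; exact: large.
  have [/codomP[b ->] | Ny] := boolP (y \in codom i); last by move=> _ ->; exact: large.
  by rewrite eE => eab fab; have := rP a b eab; rewrite !ffunE; apply.
rewrite /num_colorings -sum1_card (partition_big res [in proper_colorings e lambda mu]).
  rewrite mulnC -sum_nat_const; apply: eq_bigr => g gP.
  transitivity #|family (F g)|.
    rewrite -sum1_card; apply: eq_bigl => f; rewrite properF.
    apply/andP/idP=> [[/andP[_ fF] /eqP<-] // | fF].
    suff fg : res f = g by rewrite fg gP fF eqxx.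
    apply/ffunP=> a; have /familyP/(_ (i a)) := fF.
    by rewrite Fi inE ffunE => /eqP.
  (* The product has a factor 1 at each vertex in the image of [i] and [lambda - mu] at each other
     vertex. *)
  rewrite card_family foldrE big_map big_enum /= (bigID [in codom i]) /=.
  rewrite big1 => [|_ /codomP[a ->]]; last by rewrite Fi cards1.
  rewrite mul1n -(card_codom i_inj) -(cardC [in codom i]) addKn -prod_nat_const.
  by apply: eq_bigr => x Nx; rewrite FN // card_large_colors.
by move=> f; rewrite properF => /andP[].
Qed.

(** * The automorphisms of the cycle *)

Section Dihedral.
Local Open Scope nat_scope.

Lemma modn_lt_double n a : a < n + n -> a %% n = if a < n then a else a - n.
Proof.
move=> an; case: ltnP => [/modn_small // | na].
by rewrite -{1}(subnK na) modnDr modn_small //; lia.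
Qed.

(** Without the modulus, adjacency becomes accessible to linear arithmetic. *)
Lemma cycle_edgeE n (v w : 'I_n) : cycle_edge v w =
  [|| w == v.+1 :> nat, v == w.+1 :> nat, (v == 0 :> nat) && (w == n.-1 :> nat)
    | (w == 0 :> nat) && (v == n.-1 :> nat)].
Proof.
have [vn wn] := (ltn_ord v, ltn_ord w).
rewrite /cycle_edge !modn_lt_double; try lia.
by do 2?case: ifP => ?; apply/idP/idP => *; lia.
Qed.

Lemma val_rotation n m (v : 'I_n) : m < n ->
  rotation n m v = (if v + m < n then v + m else v + m - n) :> nat.
Proof.
by move=> mn; have vn := ltn_ord v; rewrite permE /= modn_lt_double //; lia.
Qed.

(** This is v |-> m - v modulo n, written so that the natural subtraction never truncates. *)
Definition reflection_fun n m (v : 'I_n) : 'I_n :=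
  Ordinal (ltn_pmod (m + (n - v)) (ord_pos v)).

Lemma reflection_fun_inj n m : injective (@reflection_fun n m).
Proof.
move=> v w [] /eqP; have [vn wn] := (ltn_ord v, ltn_ord w).
rewrite eqn_modDl => /eqP; rewrite !modn_lt_double; try lia.
by do 2!case: ifP => ?; move=> E; apply: val_inj => /=; lia.
Qed.

Definition reflection n m : {perm 'I_n} := perm (@reflection_fun_inj n m).

Lemma val_reflection n m (v : 'I_n) : m < n ->
  reflection n m v = (if v <= m then m - v else m + n - v) :> nat.
Proof.
move=> mn; have vn := ltn_ord v; rewrite permE /= modn_lt_double; last by lia.
by do 2!case: ifP; lia.
Qed.

Variable n : nat.
Hypothesis n_ge3 : 2 < n.

Notation Aut := (graph_aut (@cycle_edge n)).

Lemma reflection_aut m : m < n -> reflection n m \in Aut.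
Proof.
move=> mn; rewrite inE; apply/forallP=> v; apply/forallP=> w; apply/eqP.
have [vn wn] := (ltn_ord v, ltn_ord w).
rewrite !cycle_edgeE !val_reflection //.
by do 2!case: ifP; lia.
Qed.

Lemma rotation_in_rotations m : m < n -> rotation n m \in rotations n.
Proof. by move=> mn; apply/imsetP; exists (Ordinal mn). Qed.

Lemma rotation_aut m : m < n -> rotation n m \in Aut.
Proof.
by move=> mn; apply: (subsetP (rotations_sub_aut n)); exact: rotation_in_rotations.
Qed.

(** Agreement spreads around the cycle one vertex at a time, by induction on pairs of consecutive
    vertices. *)
Lemma cycle_aut_ext (g h : {perm 'I_n}) (v0 v1 : 'I_n) :
    v0 = 0 :> nat -> v1 = 1 :> nat -> g \in Aut -> h \in Aut ->
  g v0 = h v0 -> g v1 = h v1 -> g = h.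
Proof.
move=> v0E v1E; rewrite !inE => /forallP gP /forallP hP E0 E1.
have eg v w : cycle_edge (g v) (g w) = cycle_edge v w.
  by have /forallP/(_ w)/eqP := gP v.
have eh v w : cycle_edge (h v) (h w) = cycle_edge v w.
  by have /forallP/(_ w)/eqP := hP v.
have E k : forall v w : 'I_n, v = k :> nat -> w = k.+1 :> nat ->
    g v = h v /\ g w = h w.
  elim: k => [|k IH] v w vE wE.
    have -> : v = v0 by apply: val_inj; rewrite /= vE.
    by have -> : w = v1 by apply: val_inj; rewrite /= wE.
  have kn : k < n by have := ltn_ord v; lia.
  have [Eu Ev] := IH (Ordinal kn) v erefl vE; split=> //.
  set u := Ordinal kn in Eu.
  have uw : u != w by rewrite -val_eqE /=; lia.
  (* Both [g w] and [h w] are neighbors of [g v] other than [g u], and a vertex has only two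
     neighbors. *)
  have := eg v u; have := eg v w; have := eh v w; rewrite -Ev.
  have : g w != g u :> nat by rewrite (inj_eq val_inj) (inj_eq perm_inj) eq_sym.
  have : h w != g u :> nat by rewrite Eu (inj_eq val_inj) (inj_eq perm_inj) eq_sym.
  have -> : cycle_edge v w = true by rewrite cycle_edgeE wE vE eqxx.
  have -> : cycle_edge v u = true by rewrite cycle_edgeE vE eqxx orbT.
  rewrite !cycle_edgeE => *; apply: val_inj => /=.
  case: (ltn_ord (g v), ltn_ord (g u), ltn_ord (g w), ltn_ord (h w))=> [[[? ?] ?] ?]; lia.
apply/permP=> v; case: (posnP v) => [v_0|v_gt0].
  by have -> : v = v0 by apply: val_inj; rewrite /= v_0.
have pn : v.-1 < n by have := ltn_ord v; lia.
by have [|//] := E v.-1 (Ordinal pn) v erefl; lia.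
Qed.

Definition reflections : {set {perm 'I_n}} := [set reflection n m | m : 'I_n].

(** If g 0 = m, then g 1 is a neighbor of m: the successor makes g agree with a rotation at 0 and 1,
    the predecessor with a reflection. *)
Lemma cycle_autE : Aut = rotations n :|: reflections.
Proof.
apply/eqP; rewrite eqEsubset subUset rotations_sub_aut /=; apply/andP; split; last first.
  by apply/subsetP=> _ /imsetP[m _ ->]; exact: reflection_aut.
have [n0 n1] : 0 < n /\ 1 < n by lia.
pose v0 := Ordinal n0; pose v1 := Ordinal n1.
apply/subsetP=> g gA; have := gA; rewrite inE => /forallP/(_ v0)/forallP/(_ v1).
set m := g v0; rewrite [X in _ == X]cycle_edgeE /= (cycle_edgeE m) => /eqP E.
have mn := ltn_ord m; have g1n := ltn_ord (g v1); rewrite inE.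
have [Er | Er] : g v1 = rotation n m v1 \/ g v1 = reflection n m v1.
  have : (g v1 = rotation n m v1 :> nat) \/ (g v1 = reflection n m v1 :> nat).
    rewrite val_rotation // val_reflection //=.
    by do 2!case: ifP; lia.
  by case=> /val_inj; [left | right].
- suff -> : g = rotation n m by rewrite rotation_in_rotations.
  apply: (@cycle_aut_ext _ _ v0 v1) => //; first exact: rotation_aut.
  by apply: val_inj; rewrite /= val_rotation //= add0n mn.
- suff -> : g = reflection n m by rewrite [_ \in reflections]imset_f ?orbT.
  apply: (@cycle_aut_ext _ _ v0 v1) => //; first exact: reflection_aut.
  by apply: val_inj; rewrite /= val_reflection //= subn0.
Qed.

(** Equality at 0 gives a = b, and equality at 1 then makes n divide 2. *)
Lemma rotations_reflections_disjoint : [disjoint rotations n & reflections].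
Proof.
apply/pred0P=> g; apply/negP=> /andP[/imsetP[a _ ->] /imsetP[b _] E].
have [n0 n1] : 0 < n /\ 1 < n by lia.
have := congr1 (fun g : {perm 'I_n} => val (g (Ordinal n0))) E.
have := congr1 (fun g : {perm 'I_n} => val (g (Ordinal n1))) E.
rewrite /= !val_rotation // !val_reflection //=.
by have [an bn] := (ltn_ord a, ltn_ord b); do !case: ifP; lia.
Qed.

Lemma rotation_inj : injective (fun m : 'I_n => rotation n m).
Proof.
move=> a b E; have n0 : 0 < n by lia.
have := congr1 (fun g : {perm 'I_n} => val (g (Ordinal n0))) E.
by rewrite /= !val_rotation //= !add0n !ltn_ord => /val_inj.
Qed.

Lemma reflection_inj : injective (fun m : 'I_n => reflection n m).
Proof.
move=> a b E; have n0 : 0 < n by lia.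
have := congr1 (fun g : {perm 'I_n} => val (g (Ordinal n0))) E.
by rewrite /= !val_reflection //= !subn0 => /val_inj.
Qed.

Lemma card_rotations : #|rotations n| = n.
Proof. by rewrite (card_imset _ rotation_inj) card_ord. Qed.

Lemma card_cycle_aut : #|Aut| = n.*2.
Proof.
rewrite cycle_autE cardsU (disjoint_setI0 rotations_reflections_disjoint) cards0 subn0.
by rewrite card_rotations (card_imset _ reflection_inj) card_ord addnn.
Qed.

(** The last hypothesis says that [m'] is m + 2 reduced modulo n. *)
Lemma reflectionJ m m' : m < n -> m' < n -> (m' = m.+2 \/ m' + n = m.+2) ->
  (reflection n m ^ rotation n 1)%g = reflection n m'.
Proof.
move=> mn m'n E; have n1 : 1 < n by lia.
apply: (mulgI (rotation n 1)); rewrite conjgE mulVKg.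
apply/permP=> v; apply: val_inj; rewrite !permM /=.
rewrite !(val_reflection, val_rotation) //.
by have vn := ltn_ord v; do !case: ifP; lia.
Qed.

(** * Summing over the conjugacy classes of reflections *)

Variables lambda mu : nat.

Notation fix_refl m := #|fixed_colorings (@cycle_edge n) lambda mu (reflection n m)|.

Lemma num_aut_classes :
  num_coloring_classes (@cycle_edge n) lambda mu Aut * n.*2
  = num_coloring_classes (@cycle_edge n) lambda mu (rotations n) * n
    + \sum_(m < n) fix_refl m.
Proof.
have n0 : 0 < n by lia.
have := @coloring_classes_Burnside _ _ lambda mu
  (Group (rotations_group_set n0)) (rotations_sub_aut n).
rewrite /= card_rotations => ->; rewrite -card_cycle_aut.
rewrite (@coloring_classes_Burnside _ _ _ _ (graph_aut_group (@cycle_edge n))) //=.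
rewrite cycle_autE (eq_bigl _ _ (fun g => in_setU g _ _)).
rewrite (bigU _ _ _ rotations_reflections_disjoint) /=.
by congr (_ + _); rewrite big_imset //= => a b _ _; exact: reflection_inj.
Qed.

Lemma fix_reflJ m m' : m < n -> m' < n -> (m' = m.+2 \/ m' + n = m.+2) ->
  fix_refl m' = fix_refl m.
Proof.
move=> mn m'n E; rewrite -(reflectionJ mn m'n E) card_fixed_coloringsJ //.
by apply: rotation_aut; lia.
Qed.

Lemma fix_refl_odd m : m < n -> fix_refl m = fix_refl (odd m).
Proof.
have [k] := ubnP m; elim: k m => // k IH [|[|m]] // mk mn.
by rewrite (@fix_reflJ m) /= ?negbK; [apply: IH | | | left]; lia.
Qed.

Lemma sum_fix_refl_odd : odd n -> \sum_(m < n) fix_refl m = n * fix_refl n.-1.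
Proof.
move=> n_odd; have E0 : fix_refl n.-1 = fix_refl 0.
  rewrite fix_refl_odd; last by lia.
  by have -> : odd n.-1 = false by lia.
(* Adding 2 to n - 1 wraps around to 1; as n - 1 is even, this joins the two parities, and all
   reflections are conjugate. *)
have E1 : fix_refl 1 = fix_refl 0 by rewrite -E0; apply: fix_reflJ; lia.
rewrite E0 -[X in X * _]card_ord -sum_nat_const; apply: eq_bigr => m _.
by rewrite fix_refl_odd //; case: odd.
Qed.

(** Each parity of m accounts for n/2 reflections; 0 and n - 1 represent the even and the odd
    ones. *)
Lemma sum_fix_refl_even : ~~ odd n ->
  \sum_(m < n) fix_refl m = n./2 * (fix_refl 0 + fix_refl n.-1).
Proof.
move=> n_even; have -> : fix_refl n.-1 = fix_refl 1.
  rewrite fix_refl_odd; last by lia.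
  by have -> : odd n.-1 = true by lia.
have sum2 (F : bool -> nat) k :
    \sum_(m < k.*2) F (odd m) = k * (F false + F true).
  elim: k => [|k IH]; first by rewrite big_ord0.
  by rewrite doubleS !big_ord_recr /= IH odd_double /=; lia.
have := sum2 (fun b : bool => fix_refl b) n./2; rewrite even_halfK // => <-.
by apply: eq_bigr => m _; exact: fix_refl_odd.
Qed.

End Dihedral.

(** * Folding the cycle along an axis *)

Section Folding.
Local Open Scope nat_scope.
Variables (n lambda mu : nat).
Hypothesis n_ge3 : 2 < n.

(** Indexed by the number of vertices rather than the length, so the empty path is k = 0. *)
Definition path_rel k : rel 'I_k :=
  fun v w => (w == v.+1 :> nat) || (v == w.+1 :> nat).

(* The axis passes through the vertices 0 and n/2. *)
Lemma card_fixed_vertex_reflection : ~~ odd n ->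
  #|fixed_colorings (@cycle_edge n) lambda mu (reflection n 0)|
  = num_colorings (@path_rel n./2.+1) lambda mu.
Proof.
move=> n_even.
(* A vertex folds to its distance from 0. *)
have foldP (v : 'I_n) : minn v (n - v) < n./2.+1 by lia.
have unfoldP : n./2.+1 <= n by lia.
have val_s (v : 'I_n) : reflection n 0 v = (if v == 0 :> nat then 0 else n - v) :> nat.
  rewrite val_reflection ?leqn0 ?add0n; last by lia.
  by case: ifP.
apply: (@card_fixed_colorings_fold _ _ _ _ _ _ _ (fun v => Ordinal (foldP v))
  (widen_ord unfoldP)).
- by move=> a; apply: val_inj => /=; have := ltn_ord a; lia.
- move=> v; apply: val_inj; rewrite /= val_s.
  by have := ltn_ord v; case: ifP; lia.
- move=> v; have vn := ltn_ord v.
  have [?|?] : minn v (n - v) = v \/ minn v (n - v) = reflection n 0 v.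
  + by rewrite val_s; case: ifP; lia.
  + by left; apply: val_inj.
  + by right; apply: val_inj.
- move=> v w; rewrite cycle_edgeE /path_rel /=.
  by have := ltn_ord v; have := ltn_ord w; lia.
- by move=> a b eab; left; rewrite cycle_edgeE /= orbA; apply/orP; left.
Qed.

(* The axis passes through the middle of the edge {0, n-1}. *)
Lemma card_fixed_edge_reflection :
  #|fixed_colorings (@cycle_edge n) lambda mu (reflection n n.-1)|
  = (lambda - mu) ^ (~~ odd n).+1
    * num_colorings (@path_rel (uphalf n - (~~ odd n).+1)) lambda mu.
Proof.
(* The folded cycle has [h] vertices, of which [q] carry no loop: there is one loop for odd n and
   two for even n. *)
have [h hE] : {h | h = uphalf n} by exists (uphalf n).
have [q qE] : {q | q = h - (~~ odd n).+1} by exists (h - (~~ odd n).+1).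
rewrite -hE -qE.
have foldP (v : 'I_n) : minn v (n.-1 - v) < h by have := ltn_ord v; lia.
have unfoldP : h <= n by lia.
have val_s (v : 'I_n) : reflection n n.-1 v = n.-1 - v :> nat.
  by rewrite val_reflection; have := ltn_ord v; first case: ifP; lia.
(* The edge {0, n-1} folds to a loop at 0. At the other end, h - 1 is fixed by the reflection if n
   is odd, while for even n the edge {h-1, h} folds to a second loop. *)
pose e' : rel 'I_h := fun a b => path_rel a b ||
  ((a == b :> nat) && ((a == 0 :> nat) || ~~ odd n && (a == h.-1 :> nat))).
rewrite (@card_fixed_colorings_fold _ _ _ e' _ _ _ (fun v => Ordinal (foldP v))
  (widen_ord unfoldP)).
(* The unlooped vertices are 1, ..., q, hence the shift by one. *)
- have iP (a : 'I_q) : a.+1 < h by have := ltn_ord a; lia.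
  rewrite (@num_colorings_looped _ _ (@path_rel q) e' _ _ (fun a => Ordinal (iP a))).
  + by rewrite !card_ord; congr (_ ^ _ * _); lia.
  + by move=> a b [/val_inj].
  + move=> a b; rewrite /e' /path_rel /= !eqSS orbC; case: eqP => //= ab.
    by have := ltn_ord a; lia.
  + move=> x Nx; rewrite /e' eqxx /=; apply/orP; right.
    apply: contraR Nx => Nx; have xh := ltn_ord x.
    have xq : x.-1 < q by lia.
    apply/codomP; exists (Ordinal xq); apply: val_inj => /=; lia.
- by move=> a; apply: val_inj => /=; have := ltn_ord a; lia.
- move=> v; apply: val_inj; rewrite /= val_s.
  by have := ltn_ord v; lia.
- move=> v; have vn := ltn_ord v.
  have [?|?] : minn v (n.-1 - v) = v \/ minn v (n.-1 - v) = reflection n n.-1 v.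
  + by rewrite val_s; lia.
  + by left; apply: val_inj.
  + by right; apply: val_inj.
- move=> v w; have [vn wn] := (ltn_ord v, ltn_ord w).
  have val_fold (u : 'I_n) : minn u (n.-1 - u) = if u < h then (u : nat) else n.-1 - u.
    by case: ifP; lia.
  rewrite cycle_edgeE /e' /path_rel /= !val_fold.
  case/or4P=> [/eqP wE|/eqP vE|/andP[/eqP vE /eqP wE]|/andP[/eqP wE /eqP vE]].
  + by move: hE; case: (odd n) / boolP => /= n_par; do 2!case: ifP; lia.
  + by move: hE; case: (odd n) / boolP => /= n_par; do 2!case: ifP; lia.
  + by apply/orP; right; rewrite vE wE; do 2!case: ifP; lia.
  + by apply/orP; right; rewrite vE wE; do 2!case: ifP; lia.
- move=> a b; have [ah bh] := (ltn_ord a, ltn_ord b).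
  rewrite /e' !cycle_edgeE val_s /path_rel /=.
  (* A path edge lifts to itself, and a loop at a to the edge from a to its mirror image. *)
  case/orP=> [eab | /andP[/eqP <- /orP[/eqP a0 | /andP[n_par /eqP aE]]]].
  + by left; rewrite orbA eab.
  + by right; rewrite a0 subn0 !eqxx !orbT.
  + by right; apply/orP; left; lia.
Qed.

End Folding.

(** * Assembling the two parities *)

Theorem theorem11 (n lambda mu : nat) (hn : (3 <= n)%N)
    (hlambda : (0 < lambda)%N) (hmu : (mu <= lambda)%N) :
  (odd n ->
     (num_coloring_classes (@cycle_edge n) lambda mu
        (graph_aut (@cycle_edge n)))%:R
     = 1 / 2 * (num_coloring_classes (@cycle_edge n) lambda mu
          (rotations n))%:R
       + (lambda%:R - mu%:R) / 2
         * (num_colorings (@path_edge ((n - 3)./2)%N%:Z) lambda mu)%:R :> rat)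
  /\
  (~~ odd n ->
     (num_coloring_classes (@cycle_edge n) lambda mu
        (graph_aut (@cycle_edge n)))%:R
     = 1 / 2 * (num_coloring_classes (@cycle_edge n) lambda mu
          (rotations n))%:R
       + 1 / 4 * (num_colorings (@path_edge (n./2)%N%:Z) lambda mu)%:R
       + (lambda%:R - mu%:R) ^+ 2 / 4
         * (num_colorings (@path_edge ((n./2)%N%:Z - 3)) lambda mu)%:R :> rat).
Proof.
have path_edgeE l : num_colorings (@path_edge l) lambda mu
  = num_colorings (@path_rel (path_order l)) lambda mu by [].
have nz : n%:R != 0 :> rat by rewrite Num.Theory.pnatr_eq0; lia.
have := num_aut_classes hn lambda mu.
set A := num_coloring_classes _ _ _ _; set B := num_coloring_classes _ _ _ _.
move=> E; split=> n_par; rewrite !path_edgeE.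
  move: E; rewrite sum_fix_refl_odd // card_fixed_edge_reflection //.
  rewrite n_par (_ : uphalf n - _ = path_order (n - 3)./2)%N /=; last by lia.
  set P := num_colorings _ _ _ => E.
  have /(congr1 (fun k => k%:R : rat)) : (n * (A * 2) = n * (B + (lambda - mu) * P))%N.
    by lia.
  rewrite !natrM natrD natrM natrB // => /(mulfI nz) E'.
  lra.
move: E; rewrite sum_fix_refl_even // card_fixed_edge_reflection //.
rewrite card_fixed_vertex_reflection //.
(* A path of length n/2 - 3 has n/2 - 2 vertices; for n = 4 the length is -1 and both counts are
   0. *)
rewrite n_par (_ : uphalf n - _ = path_order (n./2%:Z - 3))%N /=; last first.
  by case El : (n./2%:Z - 3)%R => [l|l] /=; lia.
set P := num_colorings _ _ _; set Q := num_colorings _ _ _ => E.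
(* Doubling the count turns the factor n/2 into n, which then cancels over the rationals. *)
have /(congr1 (fun k => k%:R : rat)) :
    (n * (A * 4) = n * (B * 2 + P + (lambda - mu) ^ 2 * Q))%N.
  by nia.
rewrite !natrM !natrD !natrM natrB // => /(mulfI nz) E'.
lra.
Qed.
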